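(* Let $n\ge0$ and $1\le j<4$ be integers and let $p$ be a prime. If $p\equiv -1\pmod{2^j}$ and $\nu_p(2n+1)\equiv -1\pmod{2^{4-j}}$, then for every integer $\alpha\ge1$, $$\overline{B}_{2^{\alpha}}(2^{\alpha}(2n+1)) \equiv 0 \pmod{2^6}.$$
   Context: $\nu_p(m)$ is the exponent of the highest power of the prime $p$ dividing $m$. For an integer $k\ge 2$, $\overline{B}_k(n)$ denotes the number of $k$-regular overpartition pairs of $n$ (pairs of overpartitions with no part divisible by $k$ and with total sum of parts $n$; an overpartition is a partition in which the last occurrence of each part size may be overlined). Its generating function, as a formal power series in $q$, is $$\sum_{n=0}^{\infty} \overline{B}_{k}(n) q^n =\frac{(-q;q)^2_\infty\,(q^k;q^k)^2_\infty}{(q;q)^2_\infty\, (-q^k;q^k)^2_\infty},$$ where $(x;q)_\infty=\prod_{i=0}^\infty(1-xq^i)$. *)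

(* Defs.v *)
From mathcomp Require Import all_boot all_order all_algebra.

Set Implicit Arguments.
Unset Strict Implicit.
Unset Printing Implicit Defensive.

(* A part is a pair (size, overlined?).  Two consecutive parts u, v are in the
   order allowed in an overpartition when the sizes weakly decrease and, if the
   sizes are equal, u (which is then not the last occurrence of its size) is not
   overlined. *)
Definition overpart_rel : rel (nat * bool) :=
  fun u v => (v.1 < u.1) || ((v.1 == u.1) && ~~ u.2).

Definition is_overpartition (s : seq (nat * bool)) : bool :=
  all (fun u => 0 < u.1) s && sorted overpart_rel s.

Definition weight (s : seq (nat * bool)) : nat := \sum_(u <- s) u.1.

Definition regular (k : nat) (s : seq (nat * bool)) : bool :=
  all (fun u => ~~ (k %| u.1)) s.

Definition is_overpartition_pair (k n : nat) (s t : seq (nat * bool)) : bool :=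
  [&& is_overpartition s, is_overpartition t,
      regular k s, regular k t & weight s + weight t == n].

(* An overpartition of weight at most n has at most n parts, each at most n
   (see overpartition_bounds), so all of them occur in this finite type. *)
Definition parts_upto (n : nat) : finType := {bseq n of 'I_n.+1 * bool}.

Definition to_parts (n : nat) (s : parts_upto n) : seq (nat * bool) :=
  [seq (val u.1, u.2) | u <- bseqval s].

Definition overBpair (k n : nat) : nat :=
  #|[set st : parts_upto n * parts_upto n |
       is_overpartition_pair k n (to_parts st.1) (to_parts st.2)]|.

Lemma overpartition_bounds (n : nat) (s : seq (nat * bool)) :
  is_overpartition s -> weight s <= n ->
  size s <= n /\ all (fun u => u.1 < n.+1) s.
Proof.
case/andP=> pos_s _; elim: s n pos_s => [|u s IHs] n //= /andP[u_gt0 pos_s].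
rewrite /weight big_cons => le_n.
have le_un : u.1 <= n by apply: leq_trans le_n; apply: leq_addr.
have [|size_s bnd_s] := IHs (n - u.1) pos_s.
  by rewrite leq_subRL.
split; first by rewrite (leq_ltn_trans size_s) // ltn_subrL u_gt0 (leq_trans u_gt0).
rewrite ltnS le_un; apply: sub_all bnd_s => v /=; rewrite !ltnS => /leq_trans.
by apply; apply: leq_subr.
Qed.

(* Main.v *)
Require Import Defs.
From HB Require Import structures.
From mathcomp Require Import all_boot all_order all_algebra.
From mathcomp Require Import boolp ring zify.

Set Implicit Arguments.
Unset Strict Implicit.
Unset Printing Implicit Defensive.

(** Let phi(q) be the sum of [q^(j^2)] over the integers [j], and let
    [x = phi(q) / phi(-q)]. Overpartitions are counted by the product of
    [(1 + q^i) / (1 - q^i)], and Gauss's identity says that its inverse is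
    phi(-q); so the pairs of the theorem are counted by
    [F_a = (phi(-q^(2^a)) / phi(-q))^2] ([overBpair_theta]). The identity
    [phi(q) phi(-q) = phi(-q^2)^2] gives [F_1 = x] and, more generally,
    [F_(a+1)(q) = x(q) F_a(q^2)] ([pair_seriesS]).

    Let U send the sum of [c_n q^n] to the sum of [c_(2n) q^n]; the theorem is
    about the coefficients of U^a(F_a) at odd exponents. The equality of the
    numbers of representations of [n] and [2n] as sums of two squares yields
    [U(x) = x^2] ([evens_pair2]), and together with [x(q) x(-q) = 1] it yields
    [U(x^3) = 4 x^6 - 3 x^2] ([evens_pair2_cube]). Moreover [x = 1] modulo 4,
    hence [(x^2 - 1)^2 = 0] modulo 64, and by induction U^a(F_a) is modulo 64
    an integral combination of 1 and [x^2] ([iter_evens_pair]). Only the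
    coefficients of [x^2] at odd exponents [N] are therefore needed, and [a]
    has disappeared.

    The product formula makes the logarithmic derivative of [x] explicit:
    [q x' / x] is 4 times the sum of [sigma(N) q^N] over odd [N]. Since
    [x^2 = 1] modulo 8, the coefficient of [q^N] in [x^2], multiplied by the odd
    number [N], is [8 sigma(N)] modulo 64 ([pair2_sq_coef]). Finally 8 divides
    [sigma(N)], because the factor [1 + p + ... + p^v] of [sigma(N)], where [v]
    is the valuation of [N] at [p], is divisible by [1 + p], by [1 + p^2] when 4
    divides [v + 1], and so on ([dvd8_sigma]). *)

(** * Formal power series *)

Section PowerSeries.
Import GRing.Theory.
Local Open Scope ring_scope.

Record fps (R : Type) := Fps { coefs :> nat -> R }.

Lemma fpsP (R : Type) (f g : fps R) : f =1 g -> f = g.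
Proof. by case: f g => [f] [g] /= /funext->. Qed.

HB.instance Definition _ (R : Type) := gen_eqMixin (fps R).
HB.instance Definition _ (R : Type) := gen_choiceMixin (fps R).

Section Ring.
Variable R : comNzRingType.
Implicit Types f g h : fps R.

Definition fps_zero : fps R := Fps (fun=> 0).
Definition fps_one : fps R := Fps (fun n => (n == 0%N)%:R).
Definition fps_opp f : fps R := Fps (fun n => - f n).
Definition fps_add f g : fps R := Fps (fun n => f n + g n).
Definition fps_mul f g : fps R :=
  Fps (fun n => \sum_(i < n.+1) f i * g (n - i)%N).

Lemma fps_addA : associative fps_add.
Proof. by move=> f g h; apply: fpsP => n /=; rewrite addrA. Qed.
Lemma fps_addC : commutative fps_add.
Proof. by move=> f g; apply: fpsP => n /=; rewrite addrC. Qed.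
Lemma fps_add0 : left_id fps_zero fps_add.
Proof. by move=> f; apply: fpsP => n /=; rewrite add0r. Qed.
Lemma fps_addN : left_inverse fps_zero fps_opp fps_add.
Proof. by move=> f; apply: fpsP => n /=; rewrite addNr. Qed.

HB.instance Definition _ := GRing.isZmodule.Build (fps R)
  fps_addA fps_addC fps_add0 fps_addN.

(** Each coefficient of a product only involves finitely many coefficients, so
    the ring axioms are inherited from polynomials by truncation. *)
Definition trunc n f : {poly R} := \poly_(i < n.+1) f i.

Lemma coef_trunc n f i : (i <= n)%N -> (trunc n f)`_i = f i.
Proof. by move=> le_in; rewrite coef_poly ltnS le_in. Qed.

Lemma fps_mul_trunc n f g i : (i <= n)%N ->
  fps_mul f g i = (trunc n f * trunc n g)`_i.
Proof.
move=> le_in; rewrite coefM; apply: eq_bigr => j _.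
have le_ji : (j <= i)%N by rewrite -ltnS.
by rewrite !coef_trunc ?(leq_trans (leq_subr _ _)) ?(leq_trans le_ji).
Qed.

Lemma fps_mulC : commutative fps_mul.
Proof.
by move=> f g; apply: fpsP => n; rewrite !(@fps_mul_trunc n) // mulrC.
Qed.

Lemma fps_mulA : associative fps_mul.
Proof.
move=> f g h; apply: fpsP => n.
transitivity ((trunc n f * (trunc n g * trunc n h))`_n).
  rewrite coefM; apply: eq_bigr => i _.
  rewrite coef_trunc; last by rewrite -ltnS.
  by rewrite (@fps_mul_trunc n) // leq_subr.
rewrite mulrA coefM; apply: eq_bigr => i _.
rewrite -fps_mul_trunc; last by rewrite -ltnS.
by rewrite coef_trunc // leq_subr.
Qed.

Lemma fps_mul1 : left_id fps_one fps_mul.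
Proof.
move=> f; apply: fpsP => n /=; rewrite big_ord_recl /= mul1r subn0.
by rewrite big1 ?addr0 // => i _; rewrite mul0r.
Qed.

Lemma fps_mulDl : left_distributive fps_mul fps_add.
Proof.
move=> f g h; apply: fpsP => n /=; rewrite -big_split /=.
by apply: eq_bigr => i _; rewrite mulrDl.
Qed.

Lemma fps_oner_neq0 : fps_one != 0.
Proof.
by apply/eqP => /(congr1 (fun f : fps R => f 0%N)) /eqP; rewrite /= oner_eq0.
Qed.

HB.instance Definition _ := GRing.Zmodule_isComNzRing.Build (fps R)
  fps_mulA fps_mulC fps_mul1 fps_mulDl fps_oner_neq0.

Lemma coef_fps1 n : (1 : fps R) n = (n == 0%N)%:R.
Proof. by []. Qed.
Lemma coef_fpsD f g n : (f + g) n = f n + g n.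
Proof. by []. Qed.
Lemma coef_fpsN f n : (- f) n = - f n.
Proof. by []. Qed.
Lemma coef_fpsM f g n : (f * g) n = \sum_(i < n.+1) f i * g (n - i)%N.
Proof. by []. Qed.
Lemma coef_fps_sum (I : Type) (r : seq I) (P : pred I) (F : I -> fps R) n :
  (\sum_(i <- r | P i) F i) n = \sum_(i <- r | P i) F i n.
Proof. by elim/big_rec2: _ => //= i y1 y2 _ <-. Qed.
Lemma coef_fpsMn f k n : (f *+ k) n = f n *+ k.
Proof. by elim: k => // k IHk; rewrite !mulrS coef_fpsD IHk. Qed.
Definition q_ : fps R := Fps (fun n => (n == 1%N)%:R).

Lemma coef_qM f n : (q_ * f) n = if n is m.+1 then f m else 0.
Proof.
rewrite coef_fpsM; case: n => [|n]; first by rewrite big_ord1 mul0r.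
rewrite big_ord_recl mul0r add0r big_ord_recl mul1r big1 ?addr0 ?subn0 //.
by rewrite subSS subn0.
by move=> i _; rewrite mul0r.
Qed.

Lemma coef_qXM k f n : (q_ ^+ k * f) n = if (k <= n)%N then f (n - k)%N else 0.
Proof.
elim: k n => [|k IHk] n; first by rewrite mul1r subn0.
by rewrite exprS -mulrA coef_qM; case: n => [|n] //; rewrite IHk ltnS subSS.
Qed.

Lemma coef_qX k n : (q_ ^+ k) n = (n == k)%:R.
Proof.
rewrite -[q_ ^+ k]mulr1 coef_qXM coef_fps1 subn_eq0 eqn_leq.
by case: leqP; rewrite ?andbT ?andbF.
Qed.

(** Congruence modulo [q^(n+1)]; it is what lets finite products stand for
    infinite ones. *)
Definition agree n f g := forall i, (i <= n)%N -> f i = g i.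

Lemma agree_refl n f : agree n f f.
Proof. by []. Qed.
Lemma agree_sym n f g : agree n f g -> agree n g f.
Proof. by move=> fg i /fg. Qed.
Lemma agree_trans n g f h : agree n f g -> agree n g h -> agree n f h.
Proof. by move=> fg gh i le_in; rewrite fg ?gh. Qed.
Lemma agreeM n f f' g g' :
  agree n f f' -> agree n g g' -> agree n (f * g) (f' * g').
Proof.
move=> ff' gg' i le_in; rewrite !coef_fpsM; apply: eq_bigr => j _.
rewrite ff' ?gg' ?(leq_trans (leq_subr _ _)) //.
by apply: leq_trans le_in; rewrite -ltnS.
Qed.

Lemma agreeX n f g k : agree n f g -> agree n (f ^+ k) (g ^+ k).
Proof. by move=> fg; elim: k => // k IHk; rewrite !exprS; apply: agreeM. Qed.

(** The geometric series of [1 - f], an inverse of [f] when [f] has constant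
    coefficient 1; the coefficient of [q^n] is already reached by the partial
    sum up to [(1 - f)^n]. *)
Definition fpsV f : fps R := Fps (fun n => (\sum_(k < n.+1) (1 - f) ^+ k) n).

Lemma coef_exp_small f k n : f 0%N = 0 -> (n < k)%N -> (f ^+ k) n = 0.
Proof.
move=> f0; elim: k n => // k IHk n lt_nk; rewrite exprS coef_fpsM big1 // => i _.
have [i0 | i_gt0] := posnP i; first by rewrite i0 f0 mul0r.
by rewrite IHk ?mulr0 //; move: (ltn_ord i); lia.
Qed.

Lemma mul_fpsV f : f 0%N = 1 -> f * fpsV f = 1.
Proof.
move=> f0; apply: fpsP => n.
pose G := \sum_(k < n.+1) (1 - f) ^+ k.
have u0 : (1 - f) 0%N = 0 by rewrite coef_fpsD coef_fpsN f0 subrr.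
have VG : agree n (fpsV f) G.
  move=> i le_in; rewrite /G (bigID (fun k : 'I__ => (k < i.+1)%N)) /=.
  rewrite -(big_ord_widen _ (fun k => (1 - f) ^+ k)) //.
  rewrite [X in _ = _ + X]coef_fps_sum [X in _ = _ + X]big1 ?addr0 // => k.
  by rewrite -leqNgt => lt_ik; rewrite coef_exp_small.
rewrite (agreeM (@agree_refl n f) VG) // {VG}.
have -> : f * G = 1 - (1 - f) ^+ n.+1.
  have := subrX1 (1 - f) n.+1; rewrite -/G => defX.
  by rewrite -[1 - _]opprK opprB defX addrAC subrr add0r mulNr opprK.
by rewrite coef_fpsD coef_fpsN (coef_exp_small u0) ?subr0.
Qed.

Lemma fps_mulI f g h : f 0%N = 1 -> f * g = f * h -> g = h.
Proof.
by move=> /mul_fpsV f1 fgh; rewrite -[g]mul1r -f1 mulrAC fgh mulrAC f1 mul1r.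
Qed.

Lemma agree_mulI n f g h :
  f 0%N = 1 -> agree n (f * g) (f * h) -> agree n g h.
Proof.
move=> /mul_fpsV f1 /(agreeM (@agree_refl n (fpsV f))).
by rewrite !mulrA ![fpsV f * f]mulrC f1 !mul1r.
Qed.

Lemma coef_fpsM0 f g : (f * g) 0%N = f 0%N * g 0%N.
Proof. by rewrite coef_fpsM big_ord1. Qed.

(** The substitution of [- q] for [q]. *)
Definition fps_sgn f : fps R := Fps (fun n => (-1) ^+ n * f n).

Lemma fps_sgn_is_additive : zmod_morphism fps_sgn.
Proof. by move=> f g; apply: fpsP => n /=; rewrite mulrBr. Qed.
Lemma fps_sgn_is_monoid : monoid_morphism fps_sgn.
Proof.
split=> [|f g]; apply: fpsP => n.
  by rewrite /=; case: n => [|n]; rewrite ?mulr1 ?mulr0.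
rewrite /= mulr_sumr; apply: eq_bigr => i _.
by rewrite mulrACA -exprD subnKC // -ltnS.
Qed.
HB.instance Definition _ :=
  GRing.isZmodMorphism.Build (fps R) (fps R) fps_sgn fps_sgn_is_additive.
HB.instance Definition _ :=
  GRing.isMonoidMorphism.Build (fps R) (fps R) fps_sgn fps_sgn_is_monoid.

Lemma fps_sgnK : involutive fps_sgn.
Proof.
move=> f; apply: fpsP => n.
by rewrite /= mulrA -exprD addnn -mul2n exprM sqrrN !expr1n mul1r.
Qed.

(** The substitution of [q^k] for [q]. *)
Definition dil k f : fps R :=
  Fps (fun n => if (k %| n)%N then f (n %/ k)%N else 0).

Lemma coef_dil_mul k f n : (0 < k)%N -> dil k f (k * n)%N = f n.
Proof. by move=> k_gt0; rewrite /= dvdn_mulr // mulKn. Qed.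

Lemma dilM k f g : (0 < k)%N -> dil k (f * g) = dil k f * dil k g.
Proof.
move=> k_gt0; apply: fpsP => n; rewrite [RHS]coef_fpsM.
rewrite (bigID (fun i : 'I_n.+1 => (k %| i)%N)) /= [X in _ + X]big1 ?addr0;
  last by move=> i /negPf->; rewrite mul0r.
case: ifPn => [/dvdnP[m ->] | not_kn]; last first.
  rewrite big1 // => i k_i; rewrite k_i ifN ?mulr0 // dvdn_subl // -ltnS ltn_ord //.
rewrite mulnK //.
have inj i : (i <= m)%N -> (i * k < (m * k).+1)%N by rewrite ltnS leq_pmul2r.
rewrite (reindex_onto (fun i : 'I_m.+1 => inord (i * k) : 'I_(m * k).+1)
           (fun i => inord (i %/ k))) /=.
  have val_i (i : 'I_m.+1) : (inord (i * k) : 'I_(m * k).+1) = (i * k)%N :> nat.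
    by rewrite inordK ?inj // -ltnS.
  apply: eq_big => [i|i _]; rewrite val_i dvdn_mull // mulnK //.
    by apply/esym/eqP/val_inj; rewrite /= inordK.
  by rewrite -mulnBl dvdn_mull // mulnK.
move=> i k_i; have lt_im : (i %/ k < m.+1)%N.
  by rewrite ltnS -(leq_pmul2r k_gt0) divnK // -ltnS.
by apply: val_inj; rewrite /= (inordK lt_im) divnK // inordK.
Qed.

Lemma dil1 k : (0 < k)%N -> dil k 1 = 1.
Proof.
move=> k_gt0; apply: fpsP => n /=.
case: ifP => [/dvdnP[m ->]|]; first by rewrite mulnK // muln_eq0 (gtn_eqF k_gt0) orbF.
by case: n => //; rewrite dvdn0.
Qed.
Lemma dilD k f g : dil k (f + g) = dil k f + dil k g.
Proof. by apply: fpsP => n; rewrite coef_fpsD /=; case: ifP; rewrite ?addr0. Qed.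
Lemma dilN k f : dil k (- f) = - dil k f.
Proof. by apply: fpsP => n; rewrite coef_fpsN /=; case: ifP; rewrite ?oppr0. Qed.
Lemma dilMn k f n : dil k (f *+ n) = dil k f *+ n.
Proof.
elim: n => [|n IHn]; last by rewrite !mulrS dilD IHn.
by apply: fpsP => m; rewrite /= if_same.
Qed.
Lemma dilX k f n : (0 < k)%N -> dil k (f ^+ n) = dil k f ^+ n.
Proof. by move=> k_gt0; elim: n => [|n IHn]; rewrite ?dil1 // !exprS dilM ?IHn. Qed.
Lemma dil_dil a b f : (0 < a)%N -> (0 < b)%N -> dil a (dil b f) = dil (a * b) f.
Proof.
move=> a0 b0; apply: fpsP => n /=.
have [/dvdnP[m ->]|not_a] := boolP (a %| n)%N.
  by rewrite mulnK // [(m * a)%N]mulnC dvdn_pmul2l // divnMl.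
by rewrite ifN //; apply: contraNN not_a; apply: dvdn_trans; apply: dvdn_mulr.
Qed.
Lemma dil_qX k n : (0 < k)%N -> dil k (q_ ^+ n) = q_ ^+ (k * n).
Proof.
move=> k_gt0; apply: fpsP => i; rewrite coef_qX /= coef_qX.
have [/dvdnP[m ->]|not_a] := boolP (k %| i)%N.
  by rewrite mulnK // mulnC eqn_pmul2l.
by case: eqP not_a => // ->; rewrite dvdn_mulr.
Qed.
Lemma agree_dil k n f g :
  agree (n %/ k) f g -> agree n (dil k f) (dil k g).
Proof.
by move=> fg i le_in /=; case: ifP => // _; rewrite fg // leq_div2r.
Qed.

(** The operator U of the theory of modular forms: it keeps the even part of a
    series and replaces [q^2] by [q] in it. *)
Definition evens f : fps R := Fps (fun n => f n.*2).

Lemma evensD f g : evens (f + g) = evens f + evens g.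
Proof. exact: fpsP. Qed.
Lemma evens_is_additive : zmod_morphism evens.
Proof. by move=> f g; apply: fpsP. Qed.
HB.instance Definition _ :=
  GRing.isZmodMorphism.Build (fps R) (fps R) evens evens_is_additive.
Lemma evens_dil f : evens (dil 2 f) = f.
Proof. by apply: fpsP => n /=; rewrite -mul2n dvdn_mulr // mulKn. Qed.

(** U is linear over series in [q^2]: only the even part of [g] meets the even
    part of the product. *)
Lemma evensM f g : evens (dil 2 f * g) = f * evens g.
Proof.
apply: fpsP => n; rewrite [LHS]coef_fpsM coef_fpsM.
transitivity ((dil 2 f * dil 2 (evens g)) n.*2); last first.
  by rewrite -dilM // -mul2n coef_dil_mul.
rewrite coef_fpsM; apply: eq_bigr => i _ /=.
case: ifP => [i2|]; rewrite ?mul0r //.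
have le_i : (i <= n.*2)%N by rewrite -ltnS.
have e : (2 %| n.*2 - i)%N by rewrite dvdn_subl // -mul2n dvdn_mulr.
by rewrite e -[in LHS](divnK e) muln2.
Qed.

(** The derivation [q d/dq]. *)
Definition euler f : fps R := Fps (fun n => n%:R * f n).

Lemma coef_euler f n : euler f n = n%:R * f n.
Proof. by []. Qed.
Lemma eulerM f g : euler (f * g) = euler f * g + f * euler g.
Proof.
apply: fpsP => n; rewrite coef_fpsD !coef_fpsM -big_split /= mulr_sumr.
apply: eq_bigr => i _; rewrite -{1}(@subnKC i n) -1?ltnS // natrD mulrDl.
by rewrite mulrA mulrCA.
Qed.
Lemma eulerD f g : euler (f + g) = euler f + euler g.
Proof. by apply: fpsP => n; rewrite /= mulrDr. Qed.
Lemma eulerN f : euler (- f) = - euler f.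
Proof. by apply: fpsP => n; rewrite /= mulrN. Qed.
Lemma euler1 : euler 1 = 0.
Proof. by apply: fpsP => -[|n] /=; rewrite ?mul0r ?mulr0. Qed.
Lemma euler_qX k : euler (q_ ^+ k) = k%:R * q_ ^+ k.
Proof.
rewrite mulr_natl; apply: fpsP => n; rewrite coef_fpsMn coef_qX [LHS]/= coef_qX.
by case: eqP => [->|]; rewrite ?mulr1 // mulr0 mul0rn.
Qed.
Lemma agree_euler n f g : agree n f g -> agree n (euler f) (euler g).
Proof. by move=> fg i le_in /=; rewrite fg. Qed.

End Ring.
End PowerSeries.
Arguments q_ {R}.


(** * Counting by enumeration *)

Section Counting.
Import GRing.Theory.
Local Open Scope ring_scope.

(** An existential form of cardinality, usable for predicates over infinite
    types; the value is an integer so as to be a coefficient of a series. *)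
Definition counts (T : eqType) (P : pred T) (c : int) :=
  exists2 s : seq T, uniq s /\ s =i P & (size s)%:Z = c.

Lemma counts_uniq (T : eqType) (P : pred T) c d :
  counts P c -> counts P d -> c = d.
Proof.
move=> [s [us sP] <-] [t [ut tP] <-]; congr Posz.
by apply/perm_size/uniq_perm => // x; rewrite sP tP.
Qed.

Lemma eq_counts (T : eqType) (P Q : pred T) c :
  P =1 Q -> counts P c -> counts Q c.
Proof.
by move=> PQ [s [us sP] sc]; exists s => //; split=> // x; rewrite sP -!topredE /= PQ.
Qed.

Lemma counts0 (T : eqType) : counts (pred0 : pred T) 0.
Proof. by exists [::]. Qed.

Lemma counts1 (T : eqType) (x : T) : counts (pred1 x) 1.
Proof. by exists [:: x] => //; split=> // y; rewrite inE. Qed.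

Lemma counts_card (T : finType) (A : {set T}) : counts [pred x in A] #|A|%:Z.
Proof.
exists (enum A); last by rewrite -cardE.
by split=> [|x]; [apply: enum_uniq | rewrite mem_enum].
Qed.

Lemma countsU (T : eqType) (P Q : pred T) c d :
  (forall x, P x -> ~~ Q x) -> counts P c -> counts Q d ->
  counts [pred x | P x || Q x] (c + d).
Proof.
move=> PQ0 [s [us sP] <-] [t [ut tQ] <-].
exists (s ++ t); last by rewrite size_cat PoszD.
split=> [|x]; last by rewrite mem_cat sP tQ.
rewrite cat_uniq us ut andbT; apply/hasPn => x; rewrite tQ sP => Qx.
by apply: contraL Qx; apply: PQ0.
Qed.

Lemma counts_sum (T : eqType) (P : nat -> pred T) (c : nat -> int) m :
  (forall i j x, P i x -> P j x -> i = j) ->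
  (forall i, (i < m)%N -> counts (P i) (c i)) ->
  counts [pred x | has (P^~ x) (iota 0 m)] (\sum_(i < m) c i).
Proof.
move=> Pdis; elim: m => [|m IHm] cP.
  by rewrite big_ord0; apply: eq_counts (counts0 T).
apply: (@eq_counts _ [pred x | has (P^~ x) (iota 0 m) || P m x]) => [x|].
  by rewrite -[m.+1]addn1 /= iotaD has_cat /= add0n orbF.
rewrite big_ord_recr; apply: (countsU _ (IHm _) (cP m _)) => //.
- move=> x /= /hasP[i]; rewrite mem_iota add0n /= => lt_im Pix.
  by apply/negP => Pmx; rewrite (Pdis _ _ _ Pix Pmx) ltnn in lt_im.
by move=> i lt_im; apply: cP; apply: ltnW.
Qed.

Lemma counts_image (T T' : eqType) (P : pred T) (Q : pred T') (h : T -> T') c :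
  {in P &, injective h} -> (forall y, reflect (exists2 x, P x & y = h x) (Q y)) ->
  counts P c -> counts Q c.
Proof.
move=> h_inj Qh [s [us sP] <-]; exists (map h s); last by rewrite size_map.
split=> [|y].
  by rewrite map_inj_in_uniq // => x y; rewrite !sP; apply: h_inj.
rewrite -[y \in Q]topredE /=; apply/mapP/Qh => -[x xP ->]; exists x => //.
  by rewrite sP in xP.
by rewrite sP.
Qed.

Lemma countsX (T T' : eqType) (P : pred T) (Q : pred T') c d :
  counts P c -> counts Q d -> counts [pred u | P u.1 && Q u.2] (c * d).
Proof.
move=> [s [us sP] <-] [t [ut tQ] <-].
exists [seq (x, y) | x <- s, y <- t]; last by rewrite size_allpairs PoszM.
split=> [|[x y]].
  by apply: allpairs_uniq => // -[x y] [x' y'] _ _.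
rewrite -[RHS]/(P x && Q y); apply/allpairsP/andP => [[[a b] /= [sa tb [-> ->]]]|[Px Qy]].
  by rewrite sP in sa; rewrite tQ in tb.
by exists (x, y); rewrite sP tQ.
Qed.

(** The product rule for generating functions: a pair of total weight [n]
    splits according to the weight [i] of its first component. *)
Lemma counts_mul (T T' : eqType) (P : pred T) (Q : pred T')
    (v : T -> nat) (w : T' -> nat) (f g : fps int) n :
  (forall i, (i <= n)%N -> counts [pred x | P x && (v x == i)] (f i)) ->
  (forall i, (i <= n)%N -> counts [pred y | Q y && (w y == i)] (g i)) ->
  counts [pred u | [&& P u.1, Q u.2 & (v u.1 + w u.2 == n)%N]] ((f * g) n).
Proof.
move=> cf cg; rewrite coef_fpsM.
pose R i : pred (T * T') :=
  [pred u | (P u.1 && (v u.1 == i)) && (Q u.2 && (w u.2 == n - i)%N && (i <= n)%N)].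
apply: eq_counts (@counts_sum _ R (fun i => f i * g (n - i)%N) n.+1 _ _).
- move=> [x y]; rewrite -[LHS]/(has (R^~ (x, y)) (iota 0 n.+1)).
  rewrite -[RHS]/[&& P x, Q y & (v x + w y == n)%N].
  apply/hasP/and3P => [[i _ /= /andP[]]|[Px Qy /eqP def_n]].
    by move=> /andP[-> /eqP->] /andP[/andP[-> /eqP->] le_in]; rewrite subnKC.
  exists (v x); first by rewrite mem_iota; lia.
  by rewrite /R /= Px Qy -def_n addKn !eqxx leq_addr.
- by move=> i j u /= /andP[/andP[_ /eqP<-] _] /andP[/andP[_ /eqP<-] _].
move=> i lt_in; have le_in : (i <= n)%N by [].
apply: eq_counts (countsX (cf i le_in) (cg (n - i)%N (leq_subr _ _))) => u /=.
by rewrite /R /= le_in andbT.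
Qed.

End Counting.

(** * The generating function of regular overpartitions *)

Section Overpartitions.
Import GRing.Theory.
Local Open Scope ring_scope.

Definition reg_overpart k m s :=
  [&& is_overpartition s, regular k s & all (fun u => u.1 <= m)%N s].

(** The generating function of the [k]-regular overpartitions with parts at
    most [m]: a size [i] contributes an unrestricted number of copies, the last
    of which may be overlined. *)
Definition reg_series k m : fps int :=
  \prod_(1 <= i < m.+1 | ~~ (k %| i)%N) ((1 + q_ ^+ i) * fpsV (1 - q_ ^+ i)).

Lemma reg_series0 k : reg_series k 0 = 1.
Proof. by rewrite /reg_series big_nil. Qed.

Lemma reg_series_dvd k m : (k %| m.+1)%N -> reg_series k m.+1 = reg_series k m.
Proof.
move=> km; rewrite /reg_series big_mkcond big_nat_recr //= km mulr1.
by rewrite -big_mkcond.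
Qed.

Lemma coef0_1Bq (R : comNzRingType) m : (1 - q_ ^+ m.+1 : fps R) 0%N = 1.
Proof. by rewrite coef_fpsD coef_fpsN coef_qX coef_fps1 subr0. Qed.
Lemma coef0_1Dq (R : comNzRingType) m : (1 + q_ ^+ m.+1 : fps R) 0%N = 1.
Proof. by rewrite coef_fpsD coef_qX coef_fps1 addr0. Qed.

Lemma reg_seriesS k m : ~~ (k %| m.+1)%N ->
  reg_series k m.+1 * (1 - q_ ^+ m.+1) = reg_series k m * (1 + q_ ^+ m.+1).
Proof.
move=> km; rewrite /reg_series big_mkcond big_nat_recr //= km -big_mkcond /=.
rewrite -!mulrA [fpsV _ * _]mulrC mul_fpsV ?mulr1 //.
exact: coef0_1Bq.
Qed.

(** The recurrence that [reg_overpart_rec] realises on overpartitions: remove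
    the first part when it has the maximal size [m.+1]. *)
Lemma reg_series_rec k m n : ~~ (k %| m.+1)%N ->
  reg_series k m.+1 n = reg_series k m n +
    (if (m.+1 <= n)%N then reg_series k m.+1 (n - m.+1)%N
                           + reg_series k m (n - m.+1)%N else 0).
Proof.
move=> km; have := congr1 (fun f : fps int => f n) (reg_seriesS km).
rewrite mulrBr mulrDr !mulr1 !(mulrC _ (q_ ^+ _)) !coef_fpsD coef_fpsN !coef_qXM.
case: ifP => _; last by rewrite subr0 !addr0.
by move=> h; rewrite [RHS]addrCA -h addrC subrK.
Qed.

Lemma overpart_path_le u t : path overpart_rel u t -> all (fun v => v.1 <= u.1)%N t.
Proof.
elim: t u => //= v t IHt u /andP[uv /IHt vt].
have le_vu : (v.1 <= u.1)%N by move: uv; rewrite /overpart_rel; lia.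
by rewrite le_vu; apply: sub_all vt => w; move/leq_trans; apply.
Qed.

(** After a part [u] the sizes are at most [u.1], and at most [u.1 - 1] when
    [u] is overlined, since it is then the last part of its size; the boolean
    [u.2] is read as 0 or 1 to treat both cases at once. *)
Lemma reg_overpart_cons k m u t : reg_overpart k m (u :: t) =
  [&& (0 < u.1 <= m)%N, ~~ (k %| u.1)%N &
      reg_overpart k (u.1 - u.2)%N t].
Proof.
rewrite /reg_overpart /is_overpartition /regular /=.
case: u => [[|a] b] //=; case: (leqP a.+1 m) => [le_am|_]; last by rewrite !andbF.
have -> : path overpart_rel (a.+1, b) t =
    sorted overpart_rel t && all (fun v => v.1 <= a.+1 - b)%N t.
  case: t => //= v t; have -> : overpart_rel (a.+1, b) v = (v.1 <= a.+1 - b)%N.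
    by rewrite /overpart_rel /=; case: b; lia.
  apply/andP/and3P => [[le_v vt]|[vt le_v _]] //; split=> //.
  by apply: sub_all (overpart_path_le vt) => w /leq_trans; apply.
have le_bm : all (fun v => v.1 <= a.+1 - b)%N t -> all (fun v => v.1 <= m)%N t.
  by apply: sub_all => v le_v; lia.
case: (all (fun v => v.1 <= a.+1 - b)%N t) le_bm => [/(_ isT)->|_]; last first.
  by rewrite !andbF.
by rewrite !andbT -!andbA; do ?bool_congr.
Qed.

(** The three alternatives are: no part of size [m.+1]; a first part of size
    [m.+1] not overlined, which more such parts may follow; a first part of size
    [m.+1] overlined, which only smaller parts follow. *)
Lemma reg_overpart_rec k m n s : ~~ (k %| m.+1)%N ->
  reg_overpart k m.+1 s && (weight s == n) =
  [|| reg_overpart k m s && (weight s == n),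
    if s is u :: t then
      [&& u == (m.+1, false), reg_overpart k m.+1 t, weight t + m.+1 == n & m.+1 <= n]%N
    else false |
    if s is u :: t then
      [&& u == (m.+1, true), reg_overpart k m t, weight t + m.+1 == n & m.+1 <= n]%N
    else false].
Proof.
move=> km; case: s => [|[a b] t]; first by rewrite !orbF.
rewrite !reg_overpart_cons /weight big_cons /= -!/(weight _) !xpair_eqE.
case: (ltngtP a m.+1) => [lt_am|gt_am|->].
- by move: lt_am; rewrite ltnS => ->; rewrite /= !orbF.
- by rewrite [(a <= m)%N]leqNgt (ltnW gt_am) !andbF.
rewrite km ltnn [(m.+1 + _)%N]addnC; case: b; rewrite /= ?subSS subn0 ?orbF.
  by congr andb; apply/idP/andP => [/eqP<-|[]//]; rewrite eqxx leq_addl.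
by congr andb; apply/idP/andP => [/eqP<-|[]//]; rewrite eqxx leq_addl.
Qed.

Lemma counts_cons (u : nat * bool) P c : counts P c ->
  counts (fun s => if s is v :: t then (v == u) && P t else false) c.
Proof.
apply: (@counts_image _ _ _ _ (cons u)) => [s t _ _ [] //|[|v t]] /=.
  by constructor=> -[].
apply: (iffP andP) => [[/eqP-> Pt]|[s Ps [-> ->]]] //.
by exists t.
Qed.

Lemma reg_overpart_dvd k m s : (k %| m.+1)%N ->
  reg_overpart k m.+1 s = reg_overpart k m s.
Proof.
move=> km; case: s => // u t; rewrite !reg_overpart_cons.
have [->|u_neq] := eqVneq u.1 m.+1; first by rewrite km !andbF.
by rewrite [(u.1 <= m.+1)%N]leq_eqVlt (negPf u_neq) ltnS.
Qed.

Lemma counts_reg_overpart k m n :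
  counts [pred s | reg_overpart k m s && (weight s == n)] (reg_series k m n).
Proof.
elim: m n => [|m IHm] n.
  rewrite reg_series0 coef_fps1.
  have [->|n_neq0] := eqVneq n 0%N.
    apply: eq_counts (counts1 [::]) => -[|u t]; first by rewrite /= /weight big_nil eqxx.
    by rewrite /= reg_overpart_cons; case: u => -[|a] b.
  apply: eq_counts (counts0 _) => -[|u t]; rewrite /= ?reg_overpart_cons.
    by rewrite /weight big_nil eq_sym (negPf n_neq0).
  by case: u => -[|a] b.
have [km|km] := boolP (k %| m.+1)%N.
  rewrite reg_series_dvd //; apply: eq_counts (IHm n) => s /=.
  by rewrite reg_overpart_dvd.
elim/ltn_ind: n => n IHn; rewrite reg_series_rec //.
have [le_mn|lt_nm] := leqP m.+1 n; last first.
  rewrite addr0; apply: eq_counts (IHm n) => s.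
  rewrite [RHS](reg_overpart_rec _ _ km) /=.
  by case: s => [|u t]; rewrite ?orbF // (leqNgt m.+1) lt_nm !andbF !orbF.
have cf := counts_cons (m.+1, false) (IHn _ (_ : n - m.+1 < n)%N).
have ct := counts_cons (m.+1, true) (IHm (n - m.+1)%N).
have sub_eq w : (w + m.+1 == n)%N = (w == n - m.+1)%N.
  by apply/eqP/eqP; lia.
apply: eq_counts (countsU _ (IHm n) (countsU _ (cf _) ct)) => [s|s||] /=.
- rewrite (reg_overpart_rec _ _ km) le_mn.
  by case: s => [|u t] //; rewrite /= !andbT !sub_eq.
- case: s => [|u t] //=; rewrite reg_overpart_cons.
  case/andP=> /and3P[/andP[_ le_um] _ _] _.
  by apply/negP=> /orP[] /andP[/eqP u_def]; rewrite u_def ltnn in le_um.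
- by case=> [|u t] //= /andP[/eqP-> _]; rewrite xpair_eqE andbF.
by rewrite ltn_subrL (leq_trans _ le_mn).
Qed.

Lemma to_parts_inj n : injective (@to_parts n).
Proof.
move=> s t; rewrite /to_parts => /inj_map st; apply/val_inj/st => -[u b] [v c] /=.
by case=> /val_inj-> ->.
Qed.

Lemma to_partsP n s : is_overpartition s -> (weight s <= n)%N ->
  exists r : parts_upto n, to_parts r = s.
Proof.
move=> os ws; have [sz_s /allP le_s] := overpartition_bounds os ws.
have sz : (size [seq (inord u.1 : 'I_n.+1, u.2) | u <- s] <= n)%N by rewrite size_map.
exists (Bseq sz); rewrite /to_parts /= -map_comp -[RHS]map_id.
by apply/eq_in_map => -[a b] /le_s /= lt_an; rewrite inordK.
Qed.

Lemma overBpair_coef k n : (overBpair k n)%:Z = (reg_series k n ^+ 2) n.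
Proof.
have cX := counts_mul (fun i _ => counts_reg_overpart k n i)
                      (fun i _ => counts_reg_overpart k n i) (n := n).
rewrite expr2; apply: counts_uniq cX.
apply: (@counts_image _ _ _ _ (fun r => (to_parts r.1, to_parts r.2)) _ _ _
          (counts_card _)).
  by move=> [s t] [s' t'] _ _ [/to_parts_inj-> /to_parts_inj->].
move=> [s t] /=.
have le_all r w : is_overpartition r -> (weight r + w = n)%N ->
  all (fun u => u.1 <= n)%N r.
  move=> o_r wr; have [|_] := @overpartition_bounds n r o_r; first by lia.
  by apply: sub_all => u; rewrite ltnS.
apply: (iffP and3P) => [[/and3P[os rs _] /and3P[ot rt _] /eqP w_st]|].
  have [|r def_r] := @to_partsP n s os; first by lia.
  have [|r' def_r'] := @to_partsP n t ot; first by lia.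
  exists (r, r'); last by rewrite /= def_r def_r'.
  by rewrite /= inE /= def_r def_r' /is_overpartition_pair os ot rs rt w_st eqxx.
case=> -[r r'] /=; rewrite inE /= => /and5P[os ot rs rt w_st] [-> ->].
have w1 := eqP w_st; have w2 := eqP w_st; rewrite addnC in w2.
by split=> //; apply/and3P; split=> //; [apply: le_all w1 | apply: le_all w2].
Qed.

End Overpartitions.


(** * Gauss's product for the theta series *)

Section Theta.
Import GRing.Theory.
Local Open Scope ring_scope.

Definition is_square n := [exists i : 'I_n.+1, (i ^ 2 == n)%N].

Lemma is_squareP n : reflect (exists m, n = (m ^ 2)%N) (is_square n).
Proof.
apply: (iffP existsP) => [[i /eqP <-]|[m ->]]; first by exists (i : nat).
have lt_m : (m < (m ^ 2).+1)%N by rewrite ltnS; case: m => // m; rewrite leq_pmulr.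
by exists (Ordinal lt_m) => /=.
Qed.

(** The series phi(q), the sum of [q^(j^2)] over all integers [j]. *)
Definition theta : fps int :=
  Fps (fun n => if n == 0%N then 1 else if is_square n then 2 else 0).

Definition theta_sgn := fps_sgn theta.

Lemma counts_theta n : counts (fun j : int => `|j|%N ^ 2 == n)%N (theta n).
Proof.
rewrite /=; have [->|n_gt0] := posnP n.
  by apply: eq_counts (counts1 0) => j /=; rewrite expn_eq0 absz_eq0 andbT.
case: is_squareP => [[m def_n]|not_sq]; last first.
  apply: eq_counts (counts0 _) => j /=; apply/esym/eqP => def_n.
  by case: not_sq; exists `|j|%N.
exists [:: m%:Z; - m%:Z] => //; split=> [|j].
  by rewrite /= andbT inE; apply/eqP; lia.
rewrite !inE -topredE /= def_n eqn_exp2r //.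
by apply/orP/eqP => [[/eqP->|/eqP->]|]; lia.
Qed.

(** The partial sum of phi(-q) over [|j| <= n], where [j] and [- j] are merged
    and [j = k.+1]. *)
Definition theta_sgn_sum n : fps int :=
  1 + 2 * \sum_(0 <= k < n) (-1) ^+ k.+1 * q_ ^+ (k.+1 ^ 2).

Lemma theta_sgn_sumE n : agree n (theta_sgn_sum n) theta_sgn.
Proof.
move=> i le_in; rewrite /theta_sgn_sum coef_fpsD mulr_natl coef_fpsMn coef_fps_sum.
rewrite (eq_bigr (fun k => (-1) ^+ i * ((k.+1 ^ 2 == i)%N%:R : int))); last first.
  move=> k _; rewrite -[(-1) ^+ _]signr_odd.
  have -> : ((-1) ^+ odd k.+1 * q_ ^+ (k.+1 ^ 2) : fps int) i =
            (-1) ^+ odd k.+1 * (q_ ^+ (k.+1 ^ 2) : fps int) i.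
    by case: odd; rewrite ?mul1r // !expr1 !mulN1r.
  rewrite coef_qX eq_sym; case: eqP => [<-|]; last by rewrite !mulr0.
  by rewrite -[in RHS]signr_odd oddX.
rewrite -mulr_sumr -mulrnAr /=.
have [-> | i_gt0] := posnP i.
  by rewrite big1 ?mul0rn ?mulr0 ?addr0 // => k _; rewrite expn_eq0.
rewrite add0r; congr (_ * _).
case: is_squareP => [[[|m] def_i]|not_sq].
- by rewrite def_i in i_gt0.
- rewrite (bigD1_seq m) ?iota_uniq //= ?mem_index_iota; last first.
    by rewrite /= (leq_trans _ le_in) // def_i leq_pmulr.
  rewrite def_i eqxx big1 ?addr0 // => k; rewrite eqn_exp2r // eqSS => /negPf-> //.
by rewrite big1 // => k _; case: eqP => // def_i; case: not_sq; exists k.+1.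
Qed.

Definition gauss_factor i : fps int := (1 - q_ ^+ i) * fpsV (1 + q_ ^+ i).
Definition gauss_prod s n := \prod_(s.+1 <= i < n.+1) gauss_factor i.

Lemma gauss_prodS s n : (s <= n)%N ->
  gauss_prod s n.+1 = gauss_prod s n * gauss_factor n.+1.
Proof. by move=> le_sn; rewrite /gauss_prod big_nat_recr. Qed.
Lemma gauss_prod_head s n : (s < n)%N ->
  gauss_prod s n = gauss_factor s.+1 * gauss_prod s.+1 n.
Proof. by move=> lt_sn; rewrite /gauss_prod big_ltn. Qed.
Lemma gauss_prodnn n : gauss_prod n n = 1.
Proof. by rewrite /gauss_prod big_geq. Qed.

(** With [p_n] the product of the first [n] Gauss factors, the finite sum
    [p_n + 2 sum_(1 <= s <= n) (-1)^s (p_n / p_s) q^(s(n+1)) / (1 + q^s)]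
    equals the partial sum of phi(-q) over [|j| <= n]. Here [s = k.+1], and
    [gauss_prod s n] is the quotient [p_n / p_s]. *)
Definition shanks_term n k : fps int :=
  2 * (-1) ^+ k.+1 * gauss_prod k.+1 n * q_ ^+ (k.+1 * n.+1) * fpsV (1 + q_ ^+ k.+1).
Definition shanks_sum n : fps int :=
  gauss_prod 0 n + \sum_(0 <= k < n) shanks_term n k.

(** The increments in [n] telescope in [s], which is what makes the finite
    identity provable by induction on [n]. *)
Lemma shanks_termS n k : (k < n)%N ->
  let g j := (-1) ^+ j * gauss_prod j n * q_ ^+ (j.+1 * n.+1) in
  shanks_term n.+1 k - shanks_term n k
    = - 2 * fpsV (1 + q_ ^+ n.+1) * (g k.+1 - g k).
Proof.
move=> lt_kn /=; rewrite /shanks_term gauss_prodS // (gauss_prod_head lt_kn).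
rewrite /gauss_factor.
have := mul_fpsV (coef0_1Dq int n); have := mul_fpsV (coef0_1Dq int k).
have -> : (k.+1 * n.+2 = k.+1 * n.+1 + k.+1)%N by rewrite mulnS addnC.
have -> : (k.+2 * n.+1 = k.+1 * n.+1 + n.+1)%N by rewrite mulSn addnC.
rewrite !exprD [(-1) ^+ k.+1]exprS.
move: (q_ ^+ (k.+1 * n.+1)) (q_ ^+ k.+1) (q_ ^+ n.+1) (gauss_prod _ _) ((-1) ^+ k)
  (fpsV (1 + q_ ^+ k.+1)) (fpsV (1 + q_ ^+ n.+1)).
move=> c a b h e Vk Vn Vk1 Vn1.
apply/eqP; rewrite -subr_eq0; apply/eqP.
transitivity (- 2 * e * h * c *
   (Vk * ((1 + b) * Vn - 1) + Vn * b * (1 - (1 + a) * Vk))); first by ring.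
by rewrite Vk1 Vn1 !subrr !mulr0.
Qed.

Lemma shanks n : shanks_sum n = theta_sgn_sum n.
Proof.
elim: n => [|n IHn].
  by rewrite /shanks_sum /theta_sgn_sum !big_nil gauss_prodnn mulr0.
rewrite [RHS]/theta_sgn_sum big_nat_recr //= mulrDr addrA -/(theta_sgn_sum n) -{}IHn.
pose g j : fps int := (-1) ^+ j * gauss_prod j n * q_ ^+ (j.+1 * n.+1).
have dsum : \sum_(0 <= k < n) shanks_term n.+1 k - \sum_(0 <= k < n) shanks_term n k
          = - 2 * fpsV (1 + q_ ^+ n.+1) * (g n - g 0%N).
  rewrite -(telescope_sumr g (leq0n n)) mulr_sumr -sumrB.
  by apply: eq_big_nat => k /andP[_ lt_kn]; apply: shanks_termS.
rewrite /shanks_sum big_nat_recr //= addrA.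
rewrite -[\sum_(0 <= k < n) shanks_term n.+1 k]
  (subrK (\sum_(0 <= k < n) shanks_term n k)).
rewrite {}dsum gauss_prodS // /g /shanks_term !gauss_prodnn /gauss_factor.
have := mul_fpsV (coef0_1Dq int n).
have -> : (n.+1 * n.+2 = n.+1 ^ 2 + n.+1)%N by rewrite mulnS addnC.
rewrite mulnn mul1n !exprD [(-1) ^+ n.+1]exprS expr0.
move: (q_ ^+ (n.+1 ^ 2)) (q_ ^+ n.+1) (gauss_prod _ _) ((-1) ^+ n) (\sum_(0 <= k < n) _)
  (fpsV (1 + q_ ^+ n.+1)).
move=> c b h e S V V1; apply/eqP; rewrite -subr_eq0; apply/eqP.
transitivity ((1 - (1 + b) * V) * (2 * e * c - h)); first by ring.
by rewrite V1 subrr mul0r.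
Qed.

(** In the finite identity all terms but [p_n] are divisible by [q^(n+1)]. *)
Lemma gauss n : agree n (gauss_prod 0 n) theta_sgn.
Proof.
apply: agree_trans (theta_sgn_sumE (n := n)); rewrite -shanks /shanks_sum.
move=> i le_in.
rewrite coef_fpsD coef_fps_sum big1 ?addr0 // => k _.
rewrite /shanks_term -mulrA [_ * fpsV _]mulrC mulrA [_ * q_ ^+ _]mulrC coef_qXM.
by rewrite leqNgt (leq_trans (_ : i < n.+1)%N) ?leq_pmull.
Qed.

Lemma dil_gauss_prod k n : (0 < k)%N ->
  dil k (gauss_prod 0 (n %/ k)) = \prod_(1 <= i < n.+1 | (k %| i)%N) gauss_factor i.
Proof.
move=> k_gt0; elim: n => [|n IHn].
  by rewrite div0n /gauss_prod !big_nil dil1.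
rewrite big_mkcond big_nat_recr //= -big_mkcond -{}IHn divnS //.
case: ifP => [/dvdnP[m def_m]|_]; last by rewrite mulr1.
rewrite add1n gauss_prodS // dilM //; congr (_ * _).
have -> : (n %/ k).+1 = m.
  by have := divnS n k_gt0; rewrite def_m dvdn_mull // mulnK // add1n => <-.
have m_gt0 : (0 < m)%N by case: m def_m.
rewrite def_m [(m * k)%N]mulnC /gauss_factor dilM // dilD dilN dil1 // dil_qX //.
congr (_ * _).
have := coef0_1Dq int m.-1; rewrite prednK // => m0.
have := coef0_1Dq int (k * m).-1; rewrite prednK ?muln_gt0 ?k_gt0 // => km0.
apply: (fps_mulI km0); rewrite (mul_fpsV km0).
by have := congr1 (dil k) (mul_fpsV m0); rewrite dilM // dilD dil1 // dil_qX.
Qed.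

Lemma theta_sgn0 : theta_sgn 0%N = 1.
Proof. by []. Qed.

(** Multiplying the product over the sizes not divisible by [k]
    by the full Gauss product leaves the Gauss factors of the multiples of [k],
    that is the Gauss product in [q^k]. *)
Lemma reg_series_theta k n : (0 < k)%N ->
  agree n (reg_series k n) (dil k theta_sgn * fpsV theta_sgn).
Proof.
move=> k_gt0; apply: (agree_mulI theta_sgn0).
have -> : theta_sgn * (dil k theta_sgn * fpsV theta_sgn) = dil k theta_sgn.
  by rewrite mulrCA mul_fpsV ?mulr1.
have red : gauss_prod 0 n * reg_series k n = dil k (gauss_prod 0 (n %/ k)).
  rewrite dil_gauss_prod // /reg_series /gauss_prod.
  rewrite [X in _ * X]big_mkcond [RHS]big_mkcond.
  rewrite -big_split; apply: eq_big_nat => -[//|i] _ /=.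
  case: (k %| i.+1)%N => /=; first by rewrite mulr1.
  rewrite /gauss_factor mulrACA [_ * fpsV (1 - _)]mulrC mulrACA mulrCA.
  by rewrite (mul_fpsV (coef0_1Bq int i)) mul1r (mul_fpsV (coef0_1Dq int i)).
apply: agree_trans (agreeM (agree_sym (@gauss n)) (@agree_refl _ n _)) _.
rewrite red; apply: agree_dil; exact: gauss.
Qed.

Lemma overBpair_theta k n : (0 < k)%N ->
  (overBpair k n)%:Z = ((dil k theta_sgn * fpsV theta_sgn) ^+ 2) n.
Proof.
move=> k_gt0; rewrite overBpair_coef.
by rewrite (agreeX 2 (@reg_series_theta k n k_gt0)).
Qed.

End Theta.


(** * The dissection of x = phi(q) / phi(-q) modulo 64 *)

Section Modular.
Import GRing.Theory.
Local Open Scope ring_scope.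

Lemma counts_theta2 n :
  counts [pred u : int * int | `|u.1|%N ^ 2 + `|u.2|%N ^ 2 == n]%N ((theta ^+ 2) n).
Proof.
have c i : counts [pred j : int | predT j && (`|j|%N ^ 2 == i)%N] (theta i).
  exact: eq_counts (counts_theta i).
by rewrite expr2; apply: eq_counts (counts_mul (fun i _ => c i) (fun i _ => c i)).
Qed.

Lemma sum_sq_absz (a b : int) n :
  (`|a| ^ 2 + `|b| ^ 2 == n)%N = (a ^+ 2 + b ^+ 2 == n%:Z).
Proof.
have sq (j : int) : (`|j| ^ 2)%N%:Z = j ^+ 2.
  by rewrite expr2; case: j => m; rewrite -mulnn PoszM //= NegzE mulrNN.
by rewrite -eqz_nat PoszD !sq.
Qed.

(** The bijection [(a, b) -> (a + b, a - b)] carries the representations of [n]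
    as a sum of two squares to those of [2n]. *)
Lemma evens_theta2 : evens (theta ^+ 2) = theta ^+ 2.
Proof.
apply: fpsP => n; apply: counts_uniq (counts_theta2 n.*2) _.
apply: (@counts_image _ _ _ _ (fun u => (u.1 + u.2, u.1 - u.2)) _ _ _ (counts_theta2 n)).
  by move=> [a b] [c d] _ _ /= [h1 h2]; congr pair; lia.
move=> [a b]; rewrite /= sum_sq_absz.
have dbl (c d : int) :
  ((c + d) ^+ 2 + (c - d) ^+ 2 == n.*2%:Z) = (c ^+ 2 + d ^+ 2 == n%:Z).
  by rewrite (_ : _ + _ = (c ^+ 2 + d ^+ 2) * 2); [lia | ring].
apply: (iffP idP) => [ab_n|[[c d] /=]]; last first.
  by rewrite sum_sq_absz -dbl => cd_n [-> ->].
have par : ((a + b) %% 2)%Z = 0.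
  have : ((a ^+ 2 + b ^+ 2) %% 2)%Z = 0 by rewrite (eqP ab_n); lia.
  have sq (j : int) : (j ^+ 2 = j %[mod 2])%Z by rewrite expr2; nia.
  by rewrite -modzDm !sq modzDm.
have [a_def b_def] : a = ((a + b) %/ 2)%Z + ((a - b) %/ 2)%Z /\
                     b = ((a + b) %/ 2)%Z - ((a - b) %/ 2)%Z.
  by lia.
exists (((a + b) %/ 2)%Z, ((a - b) %/ 2)%Z) => /=; last by rewrite -a_def -b_def.
by rewrite sum_sq_absz -dbl -a_def -b_def.
Qed.

Lemma sum_sq_parity a b m : (a ^ 2 + b ^ 2 = m.*2)%N -> odd (b ^ 2) = odd m.
Proof.
move=> ab; have := congr1 odd ab; rewrite oddD !oddX odd_double /= => par.
have ea := odd_double_half a; have eb := odd_double_half b.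
move: par ea eb; case: (odd a); case: (odd b) => //= _ ea eb.
  rewrite -ea -eb in ab. nia.
rewrite -ea -eb in ab. nia.
Qed.

Lemma theta_neq0 n : theta n != 0 -> exists m, n = (m ^ 2)%N.
Proof.
rewrite /=; have [-> _|_] := eqVneq n 0%N; first by exists 0%N.
by case: is_squareP.
Qed.

Lemma fps_sgn_odd (f : fps int) n : fps_sgn f = f -> odd n -> f n = 0.
Proof.
move=> ff n_odd; have := congr1 (fun g : fps int => g n) ff.
by rewrite /= -signr_odd n_odd expr1 mulN1r; lia.
Qed.

(** The left-hand side is even because it is invariant under [q -> - q]; in a
    representation [a^2 + b^2 = 2m] the numbers [b] and [m] have the same parity,
    so its even part is that of phi(q)^2 up to the sign [(-1)^m]. *)
Lemma theta_mul_sgn : theta * theta_sgn = dil 2 (theta_sgn ^+ 2).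
Proof.
have sgn_inv : fps_sgn (theta * theta_sgn) = theta * theta_sgn.
  by rewrite rmorphM /= /theta_sgn fps_sgnK mulrC.
apply: fpsP => n; have [n_odd|n_even] := boolP (odd n).
  by rewrite (fps_sgn_odd sgn_inv n_odd) /= dvdn2 n_odd.
have -> : n = (2 * n./2)%N by rewrite mul2n even_halfK.
move: (n./2) => m; rewrite coef_dil_mul // /theta_sgn -rmorphXn -/theta_sgn.
transitivity ((-1) ^+ m * (theta ^+ 2) m) => //.
have <- : (theta ^+ 2) (2 * m)%N = (theta ^+ 2) m.
  by rewrite -[in RHS]evens_theta2 mul2n.
rewrite expr2 !coef_fpsM mulr_sumr; apply: eq_bigr => i _.
rewrite [theta_sgn _]/(_ * _) mulrCA.
have [->|/theta_neq0[a def_i]] := eqVneq (theta i) 0; first by rewrite !mul0r !mulr0.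
have [->|/theta_neq0[b def_j]] := eqVneq (theta (2 * m - i)%N) 0; first by rewrite !mulr0.
congr (_ * _); rewrite -signr_odd -[RHS]signr_odd; congr (_ ^+ nat_of_bool _).
rewrite def_j; apply: (@sum_sq_parity a).
by rewrite -def_i -def_j subnKC ?mul2n // -ltnS.
Qed.

(** By [pair2_seriesE] this is the generating function of 2-regular
    overpartition pairs; it is a modular function on which U acts by
    polynomial identities. *)
Definition pair2_series : fps int := theta * fpsV theta_sgn.
Notation x := pair2_series.

Definition pair_series a : fps int := (dil (2 ^ a) theta_sgn * fpsV theta_sgn) ^+ 2.

Lemma pair_series0 : pair_series 0 = 1.
Proof.
rewrite /pair_series; have -> : dil (2 ^ 0) theta_sgn = theta_sgn.
  by apply: fpsP => n; rewrite /= dvd1n divn1.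
by rewrite mul_fpsV // expr1n.
Qed.

Lemma pair2_seriesE : x = (dil 2 theta_sgn * fpsV theta_sgn) ^+ 2.
Proof.
rewrite exprMn -dilX // -theta_mul_sgn.
transitivity (x * (theta_sgn * fpsV theta_sgn)); last by rewrite /x; ring.
by rewrite mul_fpsV // mulr1.
Qed.

Lemma pair_seriesS a : pair_series a.+1 = x * dil 2 (pair_series a).
Proof.
rewrite pair2_seriesE /pair_series dilX // -exprMn dilM // dil_dil ?expn_gt0 // -expnS.
congr (_ ^+ 2).
transitivity (dil (2 ^ a.+1) theta_sgn * fpsV theta_sgn *
              dil 2 (theta_sgn * fpsV theta_sgn)).
  by rewrite mul_fpsV // dil1 // mulr1.
by rewrite dilM //; ring.
Qed.

(** Since [x phi(-q^2)^2 = x phi(q) phi(-q) = phi(q)^2], linearity over series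
    in [q^2] reduces U(x) to U(phi(q)^2) = phi(q)^2. *)
Lemma evens_pair2 : evens x = x ^+ 2.
Proof.
have ts2 : (theta_sgn ^+ 2) 0%N = 1 by rewrite expr2 coef_fpsM0.
apply: (fps_mulI ts2); rewrite -evensM -theta_mul_sgn.
transitivity (evens (theta ^+ 2 * (theta_sgn * fpsV theta_sgn))).
  by congr evens; rewrite /x; ring.
rewrite mul_fpsV // mulr1 evens_theta2 /x.
transitivity (theta ^+ 2 * (theta_sgn * fpsV theta_sgn) ^+ 2); last by ring.
by rewrite mul_fpsV // expr1n mulr1.
Qed.

Lemma pair2_sgn : x * fps_sgn x = 1.
Proof.
have := congr1 (fun f => fps_sgn f) (mul_fpsV theta_sgn0).
rewrite rmorph1 !rmorphM /= {1}/theta_sgn fps_sgnK -/theta_sgn => hV.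
rewrite /x.
transitivity (theta * fps_sgn (fpsV theta_sgn) * (theta_sgn * fpsV theta_sgn)).
  by ring.
by rewrite hV mul_fpsV // mulr1.
Qed.

Lemma add_sgn_evens (f : fps int) : f + fps_sgn f = 2 * dil 2 (evens f).
Proof.
apply: fpsP => n; rewrite mulr_natl coef_fpsMn coef_fpsD /= dvdn2 -signr_odd.
case: (boolP (odd n)) => [_|n_even]; first by rewrite mulN1r subrr.
by rewrite divn2 even_halfK // mul1r.
Qed.

(** As [x(q) x(-q) = 1], this is [x(q) + x(-q) = 2 U(x)(q^2)] times [x]: a
    quadratic equation for [x] over series in [q^2], from which U of every power
    of [x] follows. *)
Lemma pair2_quad : x ^+ 2 = 2 * dil 2 (x ^+ 2) * x - 1.
Proof.
have := add_sgn_evens x; rewrite evens_pair2 => <-.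
by rewrite mulrDl [fps_sgn _ * _]mulrC pair2_sgn addrK.
Qed.

Lemma evensZ (a : int) (f : fps int) : evens (a%:~R * f) = a%:~R * evens f.
Proof. by rewrite mulrzl raddfMz -mulrzl. Qed.

Lemma evens_pair2_cube : evens (x ^+ 3) = 4 * x ^+ 6 - 3 * x ^+ 2.
Proof.
set z := x ^+ 2.
have -> : x ^+ 3 = dil 2 (z ^+ 2 *+ 4 - 1) * x - dil 2 z *+ 2.
  rewrite dilD dilN dil1 // dilMn dilX //; have := pair2_quad; rewrite -/z => defz.
  transitivity (z * x); first by rewrite /z; ring.
  rewrite {1}defz; transitivity (2 * dil 2 z * z - x); first by rewrite /z; ring.
  by rewrite {2}defz; ring.
rewrite raddfB raddfMn /= evensM evens_dil evens_pair2 -/z /z; ring.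
Qed.

Lemma pair2_mod4 : exists u, x = 1 + 4 * u.
Proof.
(* phi(q) - phi(-q) doubles the odd coefficients, which are 0 or 2 *)
pose h : fps int := Fps (fun n => (odd n && is_square n)%:R).
have th : theta = theta_sgn + 4 * h.
  apply: fpsP => n; rewrite coef_fpsD mulr_natl coef_fpsMn /= -signr_odd.
  case: eqP => [->|_] //; case: is_square; case: odd => //=.
exists (h * fpsV theta_sgn); rewrite /x {1}th; move: h {th} => h.
by rewrite mulrDl mul_fpsV // -mulrA.
Qed.

Lemma pair2_sq_mod8 : exists w, x ^+ 2 = 1 + 8 * w.
Proof. by have [u ->] := pair2_mod4; exists (u + 2 * u ^+ 2); ring. Qed.

Lemma iter_evensD k (f g : fps int) :
  iter k (@evens int) (f + g) = iter k (@evens int) f + iter k (@evens int) g.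
Proof. by elim: k => //= k ->; rewrite evensD. Qed.
Lemma iter_evensMn k (f : fps int) m :
  iter k (@evens int) (f *+ m) = iter k (@evens int) f *+ m.
Proof. by elim: k => //= k ->; rewrite raddfMn. Qed.
Lemma coef_iter_evens k (f : fps int) n : iter k (@evens int) f n = f (2 ^ k * n)%N.
Proof.
elim: k n => [|k IHk] n; first by rewrite mul1n.
by rewrite /= IHk -mul2n mulnA -expnSr.
Qed.

(** One application of U turns [(a x + b x^3) F(q^2)] into
    [(a x^2 + b (4 x^6 - 3 x^2)) F], and [x^2 = 1] modulo 8 linearises this:
    [4 x^6 - 3 x^2 = 9 x^2 - 8] modulo 64. Hence the shape [a + b x^2] is stable
    modulo 64, and the induction may run over arbitrary [a] and [b]. *)
Lemma iter_evens_pair k (a b : int) : exists c d : int, exists h,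
  iter k (@evens int) ((a%:~R + b%:~R * x ^+ 2) * pair_series k)
    = c%:~R + d%:~R * x ^+ 2 + h *+ 64.
Proof.
elim: k a b => [|k IHk] a b.
  by exists a, b, 0; rewrite pair_series0 mulr1 mul0rn addr0.
have [w x2] := pair2_sq_mod8.
have [c [d [h def_h]]] := IHk (- 8 * b) (a + 9 * b).
(* 4 (1 + t)^3 - 3 (1 + t) - 9 (1 + t) + 8 = 12 t^2 + 4 t^3, at t = 8 w *)
pose h' : fps int := b%:~R * (12 * w ^+ 2 + 32 * w ^+ 3) * pair_series k.
exists c, d, (h + iter k (@evens int) h').
rewrite iterSr pair_seriesS.
have -> : evens ((a%:~R + b%:~R * x ^+ 2) * (x * dil 2 (pair_series k))) =
  ((- 8 * b)%:~R + (a + 9 * b)%:~R * x ^+ 2) * pair_series k + h' *+ 64.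
  transitivity (evens (dil 2 (pair_series k) * (a%:~R * x + b%:~R * x ^+ 3))).
    by congr evens; ring.
  rewrite evensM evensD !evensZ evens_pair2 evens_pair2_cube /h'.
  have x6 : x ^+ 6 = (x ^+ 2) ^+ 3 by rewrite -exprM.
  rewrite x6 x2.
  by ring.
by rewrite iter_evensD iter_evensMn def_h; ring.
Qed.

Lemma pair_series_coef k : exists d : int, exists h : fps int, forall n, (0 < n)%N ->
  pair_series k (2 ^ k * n)%N = d * (x ^+ 2) n + h n *+ 64.
Proof.
have [c [d [h def_h]]] := iter_evens_pair k 1 0.
exists d, h => n n_gt0; rewrite -coef_iter_evens.
have -> : pair_series k = (1%:~R + 0%:~R * x ^+ 2) * pair_series k.
  by rewrite mul0r addr0 mul1r.
rewrite def_h coef_fpsD [(h *+ 64) n]coef_fpsMn; congr (_ + _); rewrite coef_fpsD.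
have coefz z (f : fps int) : (z%:~R * f) n = z * f n.
  rewrite mulrzl; case: z => m.
    by rewrite -[LHS]/((f *+ m) n) coef_fpsMn -mulr_natl natz.
  by rewrite NegzE -[LHS]/((- (f *+ m.+1)) n) coef_fpsN coef_fpsMn mulNr -mulr_natl natz.
by rewrite coefz -[c%:~R]mulr1 coefz coef_fps1 gtn_eqF // mulr0 add0r.
Qed.

End Modular.


(** * The logarithmic derivative of x *)

Section LogDerivative.
Import GRing.Theory.
Local Open Scope ring_scope.

Definition odd_series : fps int := Fps (fun n => (odd n)%:R).

Lemma odd_seriesE : odd_series * (1 - q_ ^+ 2) = q_.
Proof.
apply: fpsP => n; rewrite mulrBr mulr1 [odd_series * _]mulrC coef_fpsD coef_fpsN coef_qXM.
case: n => [|[|n]] //=; rewrite ?subr0 // subn2 /= negbK subrr //.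
Qed.

(** Half of the logarithmic derivative of [reg_series 2 m]: the factor
    [(1 + q^i) / (1 - q^i)] contributes [2 i q^i / (1 - q^(2i))], which is [2 i]
    times the sum of [q^(i r)] over odd [r]. *)
Definition log_der m : fps int :=
  \sum_(1 <= i < m.+1 | ~~ (2 %| i)%N) i%:R * dil i odd_series.

Lemma euler_reg_series m : euler (reg_series 2 m) = 2 * reg_series 2 m * log_der m.
Proof.
elim: m => [|m IHm].
  by rewrite reg_series0 euler1 /log_der big_nil mulr0.
rewrite /log_der big_mkcond big_nat_recr //= -big_mkcond -/(log_der m) -/(2 %| m.+1)%N.
have [m2|m2] := boolP (2 %| m.+1)%N; first by rewrite reg_series_dvd // addr0 IHm.
have geo : dil m.+1 odd_series * (1 - (q_ ^+ m.+1) ^+ 2) = q_ ^+ m.+1.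
  have dil_q : dil m.+1 (q_ : fps int) = q_ ^+ m.+1.
    by rewrite -[X in dil _ X]expr1 dil_qX // muln1.
  have := congr1 (dil m.+1) odd_seriesE.
  by rewrite dil_q dilM // dilD dil1 // dilN dil_qX // exprM.
have recC := reg_seriesS m2.
have := congr1 (@euler int) recC.
rewrite !eulerM eulerD eulerN eulerD euler1 euler_qX IHm.
have a0 := coef0_1Bq int m; have b0 := coef0_1Dq int m.
move: (q_ ^+ m.+1) (dil _ _) (reg_series 2 m.+1) (reg_series 2 m) (log_der m)
  (m.+1%:R : fps int)
  a0 b0 geo recC => a g C' C L M a0 b0 geo recC der /=.
apply: (fps_mulI a0); apply: (fps_mulI b0).
apply/eqP; rewrite -subr_eq0; apply/eqP.
rewrite !add0r in der.
(* the difference is a combination of the relations der, geo and recC *)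
transitivity ((1 + a) * (euler C' * (1 - a) + C' * - (M * a)
                         - (2 * C * L * (1 + a) + C * (M * a)))
   - 2 * C' * M * (g * (1 - a ^+ 2) - a)
   - (2 * (1 + a) * L + M * a) * (C' * (1 - a) - C * (1 + a))).
  by ring.
by rewrite der recC geo !subrr !mulr0 !subr0.
Qed.

Definition sigma n := (\sum_(1 <= d < n.+1 | d %| n) d)%N.

Lemma log_der_coef n : odd n -> log_der n n = (sigma n)%:Z.
Proof.
move=> n_odd; rewrite /log_der coef_fps_sum /sigma.
rewrite (big_morph Posz PoszD (erefl 0%:Z)) [LHS]big_mkcond [RHS]big_mkcond.
apply: eq_bigr => i _; rewrite mulr_natl coef_fpsMn /= dvdn2 negbK.
have [/dvdnP[m def_n]|_] := boolP (i %| n)%N; last by rewrite mul0rn if_same.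
have /andP[m_odd i_odd] : odd m && odd i by rewrite -oddM -def_n.
rewrite i_odd def_n mulnK ?odd_gt0 // m_odd; exact: natz.
Qed.

(** As [x^2] is the fourth power of the 2-regular series, its [q d/dq]
    derivative is [8 x^2] times [log_der], and [x^2 = 1] modulo 8 removes the
    factor [x^2] modulo 64. *)
Lemma pair2_sq_coef n : odd n -> exists h : int,
  n%:Z * (pair2_series ^+ 2) n = 8 * (sigma n)%:Z + 64 * h.
Proof.
move=> n_odd; have [w x2] := pair2_sq_mod8.
have R4 : agree n (pair2_series ^+ 2) (reg_series 2 n ^+ 4).
  rewrite pair2_seriesE -exprM; apply/agreeX/agree_sym.
  exact: reg_series_theta.
exists ((w * log_der n) n).
transitivity (euler (reg_series 2 n ^+ 4) n).
  by rewrite -(agree_euler R4) // coef_euler natz.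
have -> : euler (reg_series 2 n ^+ 4) = 8 * (reg_series 2 n ^+ 4 * log_der n).
  have := euler_reg_series n; move: (reg_series 2 n) => R dR.
  by rewrite !exprS expr0 mulr1 !eulerM dR; ring.
rewrite mulr_natl coef_fpsMn.
rewrite -(agreeM R4 (@agree_refl _ n (log_der n))) // x2 mulrDl mul1r.
rewrite coef_fpsD log_der_coef // -mulrA [8 * (w * _)]mulr_natl coef_fpsMn; ring.
Qed.

End LogDerivative.

(** * Divisibility of the divisor sum *)

Section Sigma.

Lemma sigma_divisors n : 0 < n -> sigma n = \sum_(d <- divisors n) d.
Proof.
move=> n_gt0; rewrite /sigma -big_filter; apply: perm_big.
apply: uniq_perm; rewrite ?filter_uniq ?iota_uniq ?divisors_uniq // => d.
rewrite mem_filter mem_index_iota -dvdn_divisors // andb_idr // => dn.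
by rewrite (dvdn_gt0 n_gt0 dn) ltnS dvdn_leq.
Qed.

Lemma divisors_pfactor p v m : prime p -> coprime p m -> 0 < m ->
  perm_eq (divisors (p ^ v * m)) [seq p ^ i * e | i <- iota 0 v.+1, e <- divisors m].
Proof.
move=> p_pr pm m_gt0; have p_gt0 := prime_gt0 p_pr.
have log_pe i e : e \in divisors m -> logn p (p ^ i * e) = i.
  rewrite -dvdn_divisors // => em.
  rewrite lognM ?expn_gt0 ?p_gt0 ?(dvdn_gt0 m_gt0) // pfactorK //.
  by rewrite logn_coprime ?addn0 // (coprime_dvdr em).
apply: uniq_perm; rewrite ?divisors_uniq //.
  apply: allpairs_uniq; rewrite ?iota_uniq ?divisors_uniq // => -[i e] [i' e'].
  move=> h h' /= eq_pe; case/allpairsP: h => -[a b] /= [_ bm [? ?]].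
  case/allpairsP: h' => -[a' b'] /= [_ bm' [? ?]]; subst i e i' e'.
  have := congr1 (logn p) eq_pe; rewrite !log_pe // => def_a; rewrite def_a in eq_pe *.
  congr pair; apply/eqP.
  by rewrite -(eqn_pmul2l (_ : 0 < p ^ a')) ?expn_gt0 ?p_gt0 // eq_pe.
move=> d; rewrite -dvdn_divisors ?muln_gt0 ?expn_gt0 ?p_gt0 //.
apply/idP/allpairsP => [d_dvd|[[i e] [+ + ->]]]; last first.
  rewrite mem_iota add0n -dvdn_divisors //= ltnS => lt_i em.
  by rewrite dvdn_mul // dvdn_exp2l.
have d_gt0 : 0 < d by apply: dvdn_gt0 d_dvd; rewrite muln_gt0 expn_gt0 p_gt0.
have [e pe def_d] := pfactor_coprime p_pr d_gt0.
exists (logn p d, e); split; last by rewrite /= mulnC.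
  rewrite mem_iota add0n ltnS [leqLHS]/=.
  have := dvdn_leq_log p _ d_dvd; rewrite muln_gt0 expn_gt0 p_gt0 m_gt0 => /(_ isT).
  by rewrite log_pe // divisors_id.
rewrite -dvdn_divisors //= -(@Gauss_dvdr _ (p ^ v)).
  by apply: dvdn_trans d_dvd; rewrite def_d dvdn_mulr.
by rewrite coprimeXr // coprime_sym.
Qed.

Lemma sigma_pfactor p v m : prime p -> coprime p m -> 0 < m ->
  sigma (p ^ v * m) = (\sum_(i < v.+1) p ^ i) * sigma m.
Proof.
move=> p_pr pm m_gt0.
rewrite !sigma_divisors ?muln_gt0 ?expn_gt0 ?(prime_gt0 p_pr) //.
rewrite (perm_big _ (divisors_pfactor v p_pr pm m_gt0)) big_allpairs_dep.
rewrite -[iota 0 v.+1]/(index_iota 0 v.+1) big_mkord big_distrl /=.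
by apply: eq_bigr => i _; rewrite big_distrr.
Qed.

Lemma geom_double a t : \sum_(i < 2 * t) a ^ i = (1 + a) * \sum_(i < t) (a ^ 2) ^ i.
Proof.
elim: t => [|t IHt]; first by rewrite !big_ord0 muln0.
rewrite mulnS !big_ord_recr /= IHt mulnDr -addnA -expnM; congr addn.
by rewrite mulnDl mul1n -expnS.
Qed.

(** Each factor 2 in the number of terms splits off a factor [1 + p^(2^i)]:
    the first one is divisible by [2^j], and the following [3 - j] are even. *)
Lemma dvd8_geom p j v : odd p -> 1 <= j -> j < 4 ->
  2 ^ j %| p.+1 -> 2 ^ (4 - j) %| v.+1 -> 8 %| \sum_(i < v.+1) p ^ i.
Proof.
move=> p_odd j1 j4 pj /dvdnP[t ->].
have even_sq a : odd a -> 2 %| 1 + a ^ 2 by move=> a_odd; rewrite dvdn2 oddD oddX a_odd.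
have oddsq : odd (p ^ 2) by rewrite oddX p_odd.
case: j j1 j4 pj => [|[|[|[|j]]]] // _ _ pj; rewrite mulnC.
- rewrite (_ : 2 ^ (4 - 1) * t = 2 * (2 * (2 * t))) ?geom_double; last by rewrite !mulnA.
  rewrite !mulnA; apply: dvdn_mulr; apply: (@dvdn_mul 4 2); last exact: even_sq.
  by apply: (@dvdn_mul 2 2); rewrite ?even_sq.
- rewrite (_ : 2 ^ (4 - 2) * t = 2 * (2 * t)) ?geom_double; last by rewrite !mulnA.
  by rewrite mulnA; apply: dvdn_mulr; apply: (@dvdn_mul 4 2); rewrite ?even_sq.
by rewrite geom_double; apply: dvdn_mulr.
Qed.

Lemma dvd8_sigma p j n : prime p -> odd n -> 1 <= j -> j < 4 ->
  2 ^ j %| p.+1 -> 2 ^ (4 - j) %| (logn p n).+1 -> 8 %| sigma n.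
Proof.
move=> p_pr n_odd j1 j4 pj vj; have n_gt0 : 0 < n by apply: odd_gt0.
have [m pm def_n] := pfactor_coprime p_pr n_gt0.
(* the hypothesis on the valuation excludes the value 0, so p is odd *)
have v_gt0 : 0 < logn p n.
  move: vj; case: (logn p n) => //; rewrite dvdn1.
  by case: j j1 j4 {pj} => [|[|[|[|j]]]].
have p_odd : odd p.
  have p_n : p %| n by rewrite -[p]expn1 pfactor_dvdn.
  by apply: dvdn_odd p_n n_odd.
have m_gt0 : 0 < m by case: m def_n {pm} => //; move: n_gt0 => /[swap] ->.
by rewrite def_n mulnC sigma_pfactor // dvdn_mulr // (@dvd8_geom p j).
Qed.

Lemma dvd_of_modN1 (d m : nat) : (m%:Z = -1 %[mod d%:Z])%Z -> d %| m.+1.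
Proof. by move/eqP; rewrite eqz_mod_dvd GRing.opprK GRing.addrC. Qed.

End Sigma.

Theorem corollary1p1 (n j p : nat) :
  1 <= j -> j < 4 -> prime p ->
  (p%:Z = -1 %[mod (2 ^ j)%N])%Z ->
  ((logn p (2 * n + 1))%:Z = -1 %[mod (2 ^ (4 - j))%N])%Z ->
  forall alpha : nat, 1 <= alpha ->
  overBpair (2 ^ alpha) (2 ^ alpha * (2 * n + 1)) = 0 %[mod 2 ^ 6].
Proof.
move=> j1 j4 p_pr /dvd_of_modN1 pj /dvd_of_modN1 vj alpha _.
set N := 2 * n + 1 in vj *; have N_odd : odd N by rewrite /N; lia.
have /dvdnP[s def_s] := dvd8_sigma p_pr N_odd j1 j4 pj vj.
have [h x2N] := pair2_sq_coef N_odd; rewrite def_s in x2N.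
have [d [g /(_ N)]] := pair_series_coef alpha.
rewrite /pair_series -overBpair_theta ?expn_gt0 // odd_gt0 // => /(_ isT).
set c := (coefs _ N) in x2N * => def_B.
have c64 : (64 %| c)%Z.
  have cop : coprime (2 ^ 6) N by rewrite coprimeXl // coprime2n.
  rewrite -(@Gauss_dvdzr 64 N c cop) x2N PoszM.
  by apply/dvdzP; exists (s%:Z + h)%R; ring.
have /dvdzP[e B64] : (64 %| (overBpair (2 ^ alpha) (2 ^ alpha * N))%:Z)%Z.
  rewrite def_B; apply: GRing.rpredD; first exact: dvdz_mull.
  by rewrite -[(g N *+ 64)%R]GRing.mulr_natr natz dvdz_mull.
lia.
Qed.
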